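(* Let $n\ge1$, $\nu\ge0$, $\alpha\in\mathbb{R}\setminus\pi\mathbb{Z}$, let $\phi,\psi\in L^1(\mathbb{R}^n)$ be two wavelets, let $f,g\in L^{1,\nu}_{M}(\mathbb{R}^n)$ and $a\in\mathbb{R}_0^n$. Then $$\|(W_{\phi,\alpha}f)(\cdot,a)-(W_{\psi,\alpha}g)(\cdot,a)\|_{L^{1,\nu}_{M}(\mathbb{R}^n)}\leq \sqrt{|a|_{p}}\Big(\|f\|_{L^{1,\nu}_{M}(\mathbb{R}^n)}\|\phi-\psi\|_{L^1(\mathbb{R}^n)}+\|f-g\|_{L^{1,\nu}_{M}(\mathbb{R}^n)}\|\psi\|_{L^1(\mathbb{R}^n)}\Big).$$
   Context: For $x\in\mathbb{R}^n$: $\|x\|$ is the Euclidean norm, $|x|_p=|x_1x_2\cdots x_n|$, $\mathbb{R}_0^n=\{x\in\mathbb{R}^n:|x|_p\ne 0\}$; for $y\in\mathbb{R}^n_0$, $\frac{x}{y}=(x_1/y_1,\dots,x_n/y_n)$. $B(x,r)$ is the ball of center $x$ and radius $r$. The Morrey space is $L^{1,\nu}_{M}(\mathbb{R}^n)=\{f\in L^1(\mathbb{R}^n):\|f\|_{L^{1,\nu}_M(\mathbb{R}^n)}<\infty\}$, where $\|f\|_{L^{1,\nu}_{M}(\mathbb{R}^n)}=\sup_{x\in\mathbb{R}^n,r>0}\frac{1}{r^{\nu}}\int_{B(x,r)}|f(t)|\,dt$. For $a\in\mathbb{R}^n_0$, $b\in\mathbb{R}^n$: $\psi_{a,b,\alpha}(t)=\frac{1}{\sqrt{|a|_p}}\psi\left(\frac{t-b}{a}\right)e^{-\frac{i}{2}(\|t\|^2-\|b\|^2)\cot\alpha}$.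 A non-zero $\psi\in L^2(\mathbb{R}^n)$ is a wavelet if $\int_{\mathbb{R}_0^n}\int_{\mathbb{R}^n}|\langle\psi_{a,b,\alpha},\psi\rangle_{L^2(\mathbb{R}^n)}|^2\frac{db\,da}{|a|_p^2}<\infty$. The continuous fractional wavelet transform of a measurable $f$ with respect to $\psi$ is $(W_{\psi,\alpha}f)(b,a)=\int_{\mathbb{R}^n}f(t)\overline{\psi_{a,b,\alpha}(t)}\,dt$, wherever the integral exists (for fixed $a$ and the functions considered here, it exists for almost every $b$). *)

(* Defs.v *)
From HB Require Import structures.
From mathcomp Require Import all_boot all_order all_algebra.
From mathcomp Require Import complex.
From mathcomp Require Import all_classical all_reals all_analysis.

Set Implicit Arguments.
Unset Strict Implicit.
Unset Printing Implicit Defensive.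
Import Order.TTheory GRing.Theory Num.Def Num.Theory.
Import numFieldNormedType.Exports.

Local Open Scope classical_set_scope.
Local Open Scope ring_scope.

(* Tuples carry the product sigma-algebra, which over the Borel sets of R is
   the Borel sigma-algebra of R^n. *)
Definition Rn (R : realType) (n : nat) := n.-tuple (measurableTypeR R).

Section lebesgue_cons.
Context (R : realType) (n : nat).

Definition consRn (p : measurableTypeR R * Rn R n) : Rn R n.+1 :=
  [the n.+1.-tuple _ of p.1 :: p.2].

Lemma measurable_consRn : measurable_fun setT consRn.
Proof. exact: measurable_cons measurable_fst measurable_snd. Qed.

Variable m : {sigma_finite_measure set (Rn R n) -> \bar R}.

Definition lebesgue_cons : set (Rn R n.+1) -> \bar R :=
  pushforward (lebesgue_measure \x m)%E consRn.

Let push : {measure set (Rn R n.+1) -> \bar R} :=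
  measure_function_pushforward__canonical__measure_function_Measure
    (lebesgue_measure \x m)%E measurable_consRn.

Let lebesgue_cons0 : (lebesgue_cons set0 = 0)%E.
Proof. exact: (measure0 push). Qed.

Let lebesgue_cons_ge0 A : (0 <= lebesgue_cons A)%E.
Proof. exact: (measure_ge0 push). Qed.

Let lebesgue_cons_sigma_additive : semi_sigma_additive lebesgue_cons.
Proof. exact: (@measure_semi_sigma_additive _ _ _ push). Qed.

HB.instance Definition _ := isMeasure.Build _ _ _ lebesgue_cons
  lebesgue_cons0 lebesgue_cons_ge0 lebesgue_cons_sigma_additive.

Let lebesgue_cons_sigma_finite : sigma_finite setT lebesgue_cons.
Proof.
have /sigma_finiteP[F [TF ndF mF]] := sigma_finiteT (@lebesgue_measure R).
have /sigma_finiteP[G [TG ndG mG]] := sigma_finiteT m.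
pose unc (t : Rn R n.+1) : measurableTypeR R * Rn R n :=
  (thead t, [tuple of behead t]).
have consK : cancel consRn unc.
  by case=> x t; rewrite /unc /consRn theadE; congr pair; exact: val_inj.
have munc : measurable_fun setT unc.
  apply/measurable_fun_pair; first exact: measurable_tnth.
  exact: measurable_behead.
exists (fun k => unc @^-1` (F k `*` G k)).
  apply/seteqP; split => // t _ /=.
  have [i _ Fi] : (\bigcup_i F i) (unc t).1 by rewrite -TF.
  have [j _ Gj] : (\bigcup_i G i) (unc t).2 by rewrite -TG.
  exists (maxn i j) => //; split.
  - by move: Fi; exact/subsetPset/ndF/leq_maxl.
  - by move: Gj; exact/subsetPset/ndG/leq_maxr.
move=> k; have [mFk Fk] := mF k; have [mGk Gk] := mG k; split.
  by rewrite -[X in measurable X]setTI; apply: munc => //; exact: measurableX.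
rewrite /lebesgue_cons /pushforward -comp_preimage.
rewrite (_ : unc \o consRn = id); last exact/funext.
by rewrite preimage_id product_measure1E// lte_mul_pinfty// ge0_fin_numE.
Qed.

HB.instance Definition _ := Measure_isSigmaFinite.Build _ _ _ lebesgue_cons
  lebesgue_cons_sigma_finite.

End lebesgue_cons.

(* Lebesgue measure on R^n, as the n-fold product of the one on R. *)
Fixpoint lebesgue_Rn (R : realType) (n : nat) :
    {sigma_finite_measure set (Rn R n) -> \bar R} :=
  if n is n'.+1 then lebesgue_cons (lebesgue_Rn R n')
  else \d_ ([tuple] : Rn R 0).

Lemma measurable_box (R : realType) (n : nat)
    (A : 'I_n -> set (measurableTypeR R)) :
  (forall i, measurable (A i)) ->
  measurable [set x : Rn R n | forall i, A i (tnth x i)].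
Proof.
move=> mA; rewrite (_ : mkset _ =
    \bigcap_(i in [set: 'I_n]) ((fun x : Rn R n => tnth x i) @^-1` A i)); last first.
  by apply/seteqP; split => x H i => [_|]; exact: H.
apply: fin_bigcap_measurable => // i _; rewrite -[X in measurable X]setTI.
exact: (measurable_tnth i measurableT).
Qed.

Lemma lebesgue_Rn_box (R : realType) (n : nat)
    (A : 'I_n -> set (measurableTypeR R)) :
  (forall i, measurable (A i)) ->
  lebesgue_Rn R n [set x | forall i, A i (tnth x i)] =
  (\prod_(i < n) lebesgue_measure (A i))%E.
Proof.
elim: n A => [|n IHn] A mA.
  by rewrite big_ord0 /= diracE mem_set//= => -[].
rewrite big_ord_recl -(IHn (fun i => A (lift ord0 i)))//.
have -> : lebesgue_Rn R n.+1 [set x | forall i, A i (tnth x i)] =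
  (lebesgue_measure \x lebesgue_Rn R n)%E
    (A ord0 `*` [set x | forall i, A (lift ord0 i) (tnth x i)]).
  rewrite [LHS]/= /lebesgue_cons /pushforward; congr (_ _).
  apply/seteqP; split => -[x t] /=.
    move=> H; split; first exact: (H ord0).
    by move=> i; have := H (lift ord0 i); rewrite tnthS.
  by move=> [H0 H] i; case: (unliftP ord0 i) => [j ->|->//]; rewrite tnthS.
by rewrite product_measure1E//; exact: (@measurable_box R n (fun i => A (lift ord0 i))).
Qed.

(* R_0^n is Rn0, |x|_p is absp x and B(x, r) is the open ball eball x r. *)
Section euclidean.
Context (R : realType) (n : nat).
Implicit Types (x y t : Rn R n) (r : R).

Definition coord x (i : 'I_n) : R := tnth x i.

Definition subRn x y : Rn R n := [tuple coord x i - coord y i | i < n].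

Definition divRn x y : Rn R n := [tuple coord x i / coord y i | i < n].

Definition enorm x : R := Num.sqrt (\sum_(i < n) coord x i ^+ 2).

Definition absp x : R := `|\prod_(i < n) coord x i|.

Definition Rn0 : set (Rn R n) := [set x | absp x != 0].

Definition eball x r : set (Rn R n) := [set t | enorm (subRn t x) < r].

End euclidean.

Section complex_functions.
Context (R : realType) (n : nat).
Implicit Types (f g : Rn R n -> R[i]) (p : \bar R) (nu : R).
Local Notation mu := (lebesgue_Rn R n).

Definition cabs (z : R[i]) : R := ComplexField.Normc.normc z.

Definition cexpi (theta : R) : R[i] := (cos theta +i* sin theta)%C.

Definition cmeasurable f : Prop :=
  measurable_fun setT (fun t => complex.Re (f t)) /\
  measurable_fun setT (fun t => complex.Im (f t)).

(* A real or imaginary part whose integral is infinite or undefined is replaced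
   by 0. *)
Definition cintegral f : R[i] :=
  ((\int[mu]_t complex.Re (f t)) +i* (\int[mu]_t complex.Im (f t)))%C.

Definition cLnorm p f : \bar R := ('N[mu]_p [EFin \o (cabs \o f)])%E.

Definition in_L p f : Prop := cmeasurable f /\ (cLnorm p f < +oo)%E.

Definition cinner f g : R[i] := cintegral (fun t => f t * conjc (g t)).

Definition morrey_norm nu f : \bar R :=
  ereal_sup [set y | exists (x : Rn R n) (r : R), 0 < r /\
    y = ((r `^ nu)^-1%:E * \int[mu]_(t in eball x r) (cabs (f t))%:E)%E].

Definition in_morrey nu f : Prop := in_L 1 f /\ (morrey_norm nu f < +oo)%E.

End complex_functions.

Section wavelet_transform.
Context (R : realType) (n : nat) (alpha : R).
Implicit Types (psi f : Rn R n -> R[i]) (a b t : Rn R n).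
Local Notation mu := (lebesgue_Rn R n).

Definition cot (theta : R) : R := cos theta / sin theta.

Definition wavelet_atom psi a b t : R[i] :=
  ((Num.sqrt (absp a))^-1)%:C%C * psi (divRn (subRn t b) a) *
  cexpi (- (2^-1 * (enorm t ^+ 2 - enorm b ^+ 2) * cot alpha)).

Definition is_wavelet psi : Prop :=
  [/\ in_L 2%:E psi, ~ {ae mu, forall t, psi t = 0} &
   (\int[mu]_(a in @Rn0 R n) \int[mu]_b
      (cabs (cinner (wavelet_atom psi a b) psi) ^+ 2 / absp a ^+ 2)%:E
    < +oo)%E].

Definition fcwt psi f b a : R[i] :=
  cintegral (fun t => f t * conjc (wavelet_atom psi a b t)).

End wavelet_transform.

(* Main.v *)
Require Import Defs.
From mathcomp Require Import all_boot all_order all_algebra.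
From mathcomp Require Import complex.
From mathcomp Require Import all_classical all_reals all_analysis.
From mathcomp Require Import measurable_realfun.
From mathcomp Require Import ring.

(** For a fixed [b], linearity of the transform in the function and its
    conjugate linearity in the wavelet suggest
      [W_phi f - W_psi g = W_(phi - psi) f + W_psi (f - g)],
    and the chirp factor of an atom has modulus one.  After the change of
    variables [t = b + a u], whose Jacobian is [|a|_p], this gives
      [|W_phi f (b, a) - W_psi g (b, a)| <=
         sqrt |a|_p * (int |f (b + a u)| |(phi - psi) u| du
                     + int |(f - g) (b + a u)| |psi u| du)]
    ([cabs_fcwtB_le]).  Integrating over [b] in a ball [B(x, r)] and
    exchanging the integrals, the inner integral becomes the one of [|f|]
    over the translated ball [B(x + a u, r)], hence is at most
    [r^nu ||f||_M] whatever [u] is, and what remains is the [L^1] norm of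
    [phi - psi] ([integral_eball_convolution_le]): this is Young's inequality
    for a Morrey norm, and it holds because this norm is translation
    invariant.

    The defining integrals of [W_phi f] and [W_psi g] converge for almost
    every [b] only, but the pointwise bound holds for every [b].  If its right
    hand side is finite, the difference of the two integrands is integrable,
    so the real parts of the two integrands are both integrable or both not
    integrable, and in the latter case both integrals take the value 0
    ([RintegralB_default]); the imaginary parts behave in the same way,
    independently of the real ones.  Thus no exceptional null set has to be
    discarded before the bound is integrated over a ball
    ([ge0_le_integral_nonmeas]).

    The change of variables comes from the one on the line
    ([ge0_integral_affR]) by induction on the dimension. *)

Import Order.TTheory GRing.Theory Num.Theory.
Local Open Scope classical_set_scope.
Local Open Scope ring_scope.
Set Implicit Arguments.
Unset Strict Implicit.
Unset Printing Implicit Defensive.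

(* The name also denotes the coordinates in a basis of a vector space. *)
Local Notation coord := Defs.coord.

(** * Affine changes of variables *)

Section affine_line.
Context (R : realType).
Local Notation mu := (@lebesgue_measure R).

Definition affR (d c : R) : measurableTypeR R -> measurableTypeR R :=
  fun u => d + c * u.

Lemma measurable_affR d c : measurable_fun setT (affR d c).
Proof. by apply: measurable_funD => //; exact: measurable_funM. Qed.

Let affR_push d c : {measure set (measurableTypeR R) -> \bar R} :=
  measure_function_pushforward__canonical__measure_function_Measure
    mu (measurable_affR d c).

(** Both sides are measures, so that they only have to be compared on the
    intervals [`]x, y]]; the preimage of such an interval is again an interval,
    with its end points exchanged when [c < 0]. *)
Lemma lebesgue_measure_affR (d c : R) (A : set (measurableTypeR R)) :
  c != 0 -> measurable A ->
  mu A = mscale `|c|%:nng (affR_push d c) A.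
Proof.
move=> c0 mA; apply: lebesgue_measure_unique => //= _ [[x y]] _ <-.
rewrite /mscale/= /pushforward.
have [cp|cn|c0'] := ltgtP 0 c; last by rewrite -c0' eqxx in c0.
- rewrite (_ : _ @^-1` _ = `](x - d) / c, (y - d) / c]%classic); last first.
    apply/seteqP; split => u /=; rewrite !in_itv/= /affR;
    by rewrite ltr_pdivrMr// ler_pdivlMr// ltrBlDl lerBrDl (mulrC u).
  rewrite !lebesgue_measure_itv/= !lte_fin ltr_pM2r ?invr_gt0// ltrD2r.
  case: ifPn => xy; rewrite ?mule0// -!EFinD -EFinM gtr0_norm//.
  by rewrite -mulrBl mulrC divfK// opprB addrA subrK.
- rewrite (_ : _ @^-1` _ = `[(y - d) / c, (x - d) / c[%classic); last first.
    apply/seteqP; split => u /=; rewrite !in_itv/= /affR;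
    by rewrite ltr_ndivlMr// ler_ndivrMr// ltrBlDl lerBrDl (mulrC u) andbC.
  rewrite !lebesgue_measure_itv/= !lte_fin ltr_nM2r ?invr_lt0// ltrD2r.
  case: ifPn => xy; rewrite ?mule0// -!EFinD -EFinM ltr0_norm//.
  by rewrite -mulrBl mulrC mulrN divfK// opprB opprB addrA subrK.
Qed.

Lemma ge0_integral_affR (d c : R) (F : measurableTypeR R -> \bar R) :
  c != 0 -> measurable_fun setT F -> (forall x, 0 <= F x)%E ->
  (\int[mu]_x F x = (`|c|%R)%:E * \int[mu]_u F (affR d c u))%E.
Proof.
move=> c0 mF F0.
transitivity (\int[mscale (`|c|%:nng)%R (affR_push d c)]_x F x)%E.
  by apply: eq_measure_integral => A mA _; exact: lebesgue_measure_affR.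
rewrite ge0_integral_mscale//=; congr (_ * _)%E.
by rewrite ge0_integral_pushforward//; exact: measurable_affR.
Qed.

End affine_line.

Section affine_Rn.
Context (R : realType).

(** The map [u |-> b + a u], where the product is taken coordinatewise. *)
Definition affRn n (b a u : Rn R n) : Rn R n :=
  [tuple coord b i + coord a i * coord u i | i < n].

Lemma coord_affRn n (b a u : Rn R n) i :
  coord (affRn b a u) i = coord b i + coord a i * coord u i.
Proof. by rewrite /Defs.coord tnth_mktuple. Qed.

Lemma measurable_coord d (T : measurableType d) n (h : T -> Rn R n) i :
  measurable_fun setT h -> measurable_fun setT (fun x => coord (h x) i).
Proof.
exact: (measurableT_comp (measurable_tnth i)).
Qed.

Lemma measurable_affRn d (T : measurableType d) n (hb hu : T -> Rn R n) a :
  measurable_fun setT hb -> measurable_fun setT hu ->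
  measurable_fun setT (fun x => affRn (hb x) a (hu x)).
Proof.
move=> mb mu; apply/measurable_fun_tnthP => i.
rewrite (_ : _ \o _ = fun x => coord (hb x) i + coord a i * coord (hu x) i).
  apply: measurable_funD; first exact: measurable_coord.
  by apply: measurable_funM => //; exact: measurable_coord.
by apply/funext => x /=; rewrite tnth_mktuple.
Qed.

Lemma tnth_lift0 T n (t : n.+1.-tuple T) (j : 'I_n) :
  tnth t (lift ord0 j) = tnth [tuple of behead t] j.
Proof. by rewrite [in LHS](tuple_eta t) tnthS. Qed.

Lemma affRn_cons n (b a : Rn R n.+1) (x : R) (t : Rn R n) :
  affRn b a (consRn (x, t)) =
  consRn (affR (thead b) (thead a) x,
          affRn [tuple of behead b] [tuple of behead a] t).
Proof.
apply: eq_from_tnth => i; rewrite tnth_mktuple /coord.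
case: (unliftP ord0 i) => [j|] ->.
  by rewrite !tnthS tnth_mktuple /Defs.coord !tnth_lift0.
by [].
Qed.

Lemma absp_cons n (a : Rn R n.+1) :
  absp a = `|thead a| * absp [tuple of behead a].
Proof.
rewrite /absp big_ord_recl normrM; congr (_ * `|_|).
by apply: eq_bigr => i _; rewrite /Defs.coord tnth_lift0.
Qed.

Lemma ge0_integral_consRn n (F : Rn R n.+1 -> \bar R) :
  measurable_fun setT F -> (forall x, 0 <= F x)%E ->
  (\int[lebesgue_Rn R n.+1]_x F x =
   \int[lebesgue_measure]_x \int[lebesgue_Rn R n]_t F (consRn (x, t)))%E.
Proof.
move=> mF F0.
transitivity (\int[pushforward (lebesgue_measure \x lebesgue_Rn R n)%E
  (@consRn R n)]_x F x)%E.
  by [].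
rewrite (ge0_integral_pushforward (@measurable_consRn R n))// preimage_setT.
rewrite fubini_tonelli1//; last by move=> p; exact: F0.
by apply: measurableT_comp => //; exact: measurable_consRn.
Qed.

(** A coordinatewise affine map acts on the first coordinate and on the other
    ones separately, so Tonelli's theorem splits the change of variables into
    one on the line and one in the lower dimension. *)
Lemma ge0_integral_affRn n (b a : Rn R n) (F : Rn R n -> \bar R) :
  absp a != 0 -> measurable_fun setT F -> (forall x, 0 <= F x)%E ->
  (\int[lebesgue_Rn R n]_x F x =
   (absp a)%:E * \int[lebesgue_Rn R n]_u F (affRn b a u))%E.
Proof.
elim: n => [|n IHn] in b a F *.
  move=> _ mF F0; rewrite /absp big_ord0 normr1 mul1e.
  by apply: eq_integral => u _; rewrite [affRn _ _ _]tuple0 [u]tuple0.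
rewrite absp_cons mulf_eq0 negb_or normr_eq0 => /andP[a0 an0] mF F0.
have mFc : measurable_fun setT (F \o @consRn R n).
  by apply: measurableT_comp => //; exact: measurable_consRn.
have mFa : measurable_fun setT (fun p => F (affRn b a (@consRn R n p))).
  apply: measurableT_comp => //; apply: measurable_affRn => //.
  exact: measurable_consRn.
rewrite !ge0_integral_consRn//; last first.
  by apply: measurableT_comp => //; exact: measurable_affRn.
pose G x := (\int[lebesgue_Rn R n]_t F (consRn (x, t)))%E.
have mG : measurable_fun setT G.
  exact: (@measurable_fun_fubini_tonelli_F _ _ _ _ _ (lebesgue_Rn R n) _ mFc
    (fun p => F0 (consRn p))).
rewrite [LHS](ge0_integral_affR (thead b) a0 mG); last first.
  by move=> x; exact: integral_ge0.
rewrite EFinM -muleA; congr (_ * _)%E.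
rewrite -ge0_integralZl//; last 3 first.
- exact: (@measurable_fun_fubini_tonelli_F _ _ _ _ _ (lebesgue_Rn R n) _ mFa
    (fun p => F0 (affRn b a (consRn p)))).
- by move=> x _; exact: integral_ge0.
- by rewrite lee_fin normr_ge0.
apply: eq_integral => x _.
rewrite /G (IHn [tuple of behead b] [tuple of behead a])//.
  by congr (_ * _)%E; apply: eq_integral => t _; rewrite affRn_cons.
apply: measurableT_comp => //.
by apply: (measurableT_comp (@measurable_consRn R n)); exact: measurable_pair1.
Qed.

End affine_Rn.

(** * Integrals of complex functions, with a default value *)

Section Rintegral_default.
Context d (T : measurableType d) (R : realType).
Variable mu : {measure set T -> \bar R}.
Implicit Types u v : T -> R.

(** One of the integrals of the positive and negative parts is infinite, hence
    so is their difference, whose real value is 0 by convention. *)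
Lemma Rintegral_nonintegrable u : measurable_fun setT u ->
  ~ mu.-integrable setT (EFin \o u) -> Rintegral mu setT u = 0.
Proof.
move=> meas_u nint; rewrite /Rintegral integralE.
set p := integral _ _ _; set q := integral _ _ _.
have meu : measurable_fun setT (EFin \o u) by exact/measurable_EFinP.
have p0 : (0 <= p)%E by exact: integral_ge0.
have q0 : (0 <= q)%E by exact: integral_ge0.
have pq : (p + q)%E = +oo%E.
  apply/eqP; rewrite -leye_eq leNgt; apply/negP => h; apply: nint.
  apply/integrableP; split => //.
  rewrite -[fun x => _]/(abse \o (EFin \o u)) fune_abse ge0_integralD//.
  - exact: measurable_funepos.
  - exact: measurable_funeneg.
by move: p q p0 q0 pq => [p| |] [q| |].
Qed.

(** The function [u] is integrable if and only if [v] is, since their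
    difference is.  If both are, [e = 1]; otherwise both integrals on the left
    are the default value 0, and [e = 0].  An idempotent factor treats the two
    cases at once. *)
Lemma RintegralB_default u v :
  measurable_fun setT u -> measurable_fun setT v ->
  mu.-integrable setT (EFin \o (u \- v)) ->
  exists2 e : R, e * e = e &
    Rintegral mu setT u - Rintegral mu setT v = e * Rintegral mu setT (u \- v).
Proof.
move=> meas_u mv iuv.
have [iv|niv] := pselect (mu.-integrable setT (EFin \o v)).
  exists 1; rewrite !mul1r// RintegralB//.
  rewrite (_ : _ \o _ = (EFin \o (u \- v)%R) \+ (EFin \o v))%E.
    exact: integrableD.
  by apply/funext => x /=; rewrite -EFinD subrK.
exists 0; rewrite !mul0r// !Rintegral_nonintegrable ?subrr// => iu.
apply: niv; rewrite (_ : _ \o _ = (EFin \o u) \- (EFin \o (u \- v)%R))%E.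
  exact: integrableB.
by apply/funext => x /=; rewrite -EFinB opprB addrC subrK.
Qed.

End Rintegral_default.

Section complex_integral.
Context (R : realType) (n : nat).
Local Notation mu := (lebesgue_Rn R n).
Implicit Types u v : Rn R n -> R[i].

Lemma cabsE (z : R[i]) :
  cabs z = Num.sqrt (complex.Re z ^+ 2 + complex.Im z ^+ 2).
Proof. by case: z. Qed.

Lemma cabs_ge0 (z : R[i]) : 0 <= cabs z.
Proof. by rewrite cabsE sqrtr_ge0. Qed.

Lemma cabsM (y z : R[i]) : cabs (y * z) = cabs y * cabs z.
Proof. exact: ComplexField.Normc.normcM. Qed.

Lemma cabsD (y z : R[i]) : cabs (y + z) <= cabs y + cabs z.
Proof. exact: (@le_normcD R). Qed.

Lemma cabs_conj (z : R[i]) : cabs (conjc z) = cabs z.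
Proof. by rewrite !cabsE; case: z => x y /=; rewrite sqrrN. Qed.

Lemma cabs_real (x : R) : cabs x%:C%C = `|x|.
Proof. by rewrite cabsE /= expr0n addr0 sqrtr_sqr. Qed.

Lemma cabs_cexpi (x : R) : cabs (cexpi x) = 1.
Proof. by rewrite cabsE /= cos2Dsin2 sqrtr1. Qed.

Lemma normr_Re_le_cabs (z : R[i]) : `|complex.Re z| <= cabs z.
Proof.
by rewrite cabsE -sqrtr_sqr ler_wsqrtr// lerDl sqr_ge0.
Qed.

Lemma normr_Im_le_cabs (z : R[i]) : `|complex.Im z| <= cabs z.
Proof.
by rewrite cabsE -sqrtr_sqr ler_wsqrtr// lerDr sqr_ge0.
Qed.

(** The Cauchy-Schwarz inequality in the plane. *)
Lemma dot_le_cabs (x y : R) (z : R[i]) :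
  x * complex.Re z + y * complex.Im z <= Num.sqrt (x ^+ 2 + y ^+ 2) * cabs z.
Proof.
rewrite cabsE -sqrtrM ?addr_ge0 ?sqr_ge0//.
apply: le_trans (ler_norm _) _; rewrite -sqrtr_sqr ler_wsqrtr//.
rewrite -subr_ge0.
have -> : (x ^+ 2 + y ^+ 2) * (complex.Re z ^+ 2 + complex.Im z ^+ 2) -
    (x * complex.Re z + y * complex.Im z) ^+ 2 =
    (x * complex.Im z - y * complex.Re z) ^+ 2 by ring.
exact: sqr_ge0.
Qed.

Lemma measurable_cabs u : cmeasurable u -> measurable_fun setT (@cabs R \o u).
Proof.
move=> [mr mi]; rewrite (_ : _ \o _ = Num.sqrt \o
    (fun t => complex.Re (u t) ^+ 2 + complex.Im (u t) ^+ 2)); last first.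
  by apply/funext => t /=; rewrite cabsE.
apply: measurableT_comp.
  exact: continuous_measurable_fun (@sqrt_continuous R).
by apply: measurable_funD; exact: measurable_funX.
Qed.

Lemma cmeasurableB u v : cmeasurable u -> cmeasurable v ->
  cmeasurable (fun t => u t - v t).
Proof.
move=> [ur ui] [vr vi]; split.
  by under eq_fun do rewrite raddfB/=; exact: measurable_funB.
by under eq_fun do rewrite raddfB/=; exact: measurable_funB.
Qed.

Lemma cmeasurableM u v : cmeasurable u -> cmeasurable v ->
  cmeasurable (fun t => u t * v t).
Proof.
move=> [ur ui] [vr vi]; split.
  rewrite (_ : (fun t => _) = fun t => complex.Re (u t) * complex.Re (v t) -
    complex.Im (u t) * complex.Im (v t)).
    by apply: measurable_funB; exact: measurable_funM.
  by apply/funext => t; case: (u t) (v t) => ? ? [].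
rewrite (_ : (fun t => _) = fun t => complex.Re (u t) * complex.Im (v t) +
    complex.Im (u t) * complex.Re (v t)).
  by apply: measurable_funD; exact: measurable_funM.
by apply/funext => t; case: (u t) (v t) => ? ? [].
Qed.

Lemma cmeasurable_conj u : cmeasurable u -> cmeasurable (fun t => conjc (u t)).
Proof.
move=> [ur ui]; split.
  rewrite (_ : (fun t => _) = (fun t => complex.Re (u t))) //.
  by apply/funext => t; case: (u t).
rewrite (_ : (fun t => _) = (fun t => - complex.Im (u t))).
  exact: measurable_funN.
by apply/funext => t; case: (u t).
Qed.

(** The bound is trivial unless [h = u - v] is integrable.  In that case let [A]
    and [B] be the integrals of its real and imaginary parts.  The difference of
    the two integrals is [e A + i e' B] with idempotent [e] and [e'].  As for
    the usual triangle inequality, its modulus [N] satisfies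
      [N ^ 2 = (e A) A + (e' B) B = int ((e A) Re h + (e' B) Im h)
             <= N * int |h|],
    where the first equality is idempotence. *)
Lemma cabs_cintegralB_le u v : cmeasurable u -> cmeasurable v ->
  ((cabs (cintegral u - cintegral v))%:E <=
   \int[mu]_t (cabs (u t - v t))%:E)%E.
Proof.
move=> meas_u mv; pose h t := u t - v t.
have mh : cmeasurable h by exact: cmeasurableB.
have mch : measurable_fun setT (EFin \o (@cabs R \o h)).
  by apply/measurable_EFinP; exact: (measurable_cabs mh).
have H0 : (0 <= \int[mu]_t (cabs (h t))%:E)%E.
  by apply: integral_ge0 => t _; rewrite lee_fin cabs_ge0.
have [->|Hfin] := eqVneq (\int[mu]_t (cabs (h t))%:E)%E +oo%E.
  exact: leey.
have ich : mu.-integrable setT (EFin \o (@cabs R \o h)).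
  apply/integrableP; split => //.
  under eq_integral do rewrite gee0_abs ?lee_fin ?cabs_ge0//.
  by rewrite ltey.
have iRe : mu.-integrable setT (EFin \o ((fun t => complex.Re (u t)) \-
    (fun t => complex.Re (v t)))%R).
  apply: le_integrable ich => //.
    by apply/measurable_EFinP; apply: measurable_funB; [case: meas_u|case: mv].
  move=> t _ /=; rewrite lee_fin [leRHS]ger0_norm ?cabs_ge0//.
  by rewrite -raddfB; exact: normr_Re_le_cabs.
have iIm : mu.-integrable setT (EFin \o ((fun t => complex.Im (u t)) \-
    (fun t => complex.Im (v t)))%R).
  apply: le_integrable ich => //.
    by apply/measurable_EFinP; apply: measurable_funB; [case: meas_u|case: mv].
  move=> t _ /=; rewrite lee_fin [leRHS]ger0_norm ?cabs_ge0//.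
  by rewrite -raddfB; exact: normr_Im_le_cabs.
have iZ k w : mu.-integrable setT (EFin \o w) ->
    mu.-integrable setT (EFin \o (fun t => k * w t)).
  by move=> iw; exact: (integrableZl measurableT k iw).
have iAB k l : mu.-integrable setT (EFin \o
    (fun t => k * (complex.Re (u t) - complex.Re (v t)) +
              l * (complex.Im (u t) - complex.Im (v t)))).
  by exact: (integrableD measurableT (iZ k _ iRe) (iZ l _ iIm)).
have [e ee eE] := RintegralB_default meas_u.1 mv.1 iRe.
have [e' ee' e'E] := RintegralB_default meas_u.2 mv.2 iIm.
set A := (X in _ = _ * X) in eE; set B := (X in _ = _ * X) in e'E.
have HE : (\int[mu]_t (cabs (h t))%:E)%E =
    (Rintegral mu setT (@cabs R \o h))%:E.
  by rewrite fineK// ge0_fin_numE// ltey.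
rewrite HE lee_fin cabsE !raddfB/= eE e'E.
have : (e * A) * A + (e' * B) * B = (e * A) ^+ 2 + (e' * B) ^+ 2.
  by rewrite !expr2 mulrACA ee mulrACA ee' !mulrA.
move: (e * A) (e' * B) => a b ABE.
set N := Num.sqrt _.
have N0 : 0 <= N by exact: sqrtr_ge0.
have key : N ^+ 2 <= N * Rintegral mu setT (@cabs R \o h).
  rewrite sqr_sqrtr ?addr_ge0 ?sqr_ge0// -ABE.
  rewrite -!RintegralZl// -RintegralD//; [|exact: iZ..].
  apply: le_Rintegral; [by []|exact: iAB|exact: (iZ _ _ ich)|].
  by move=> t _ /=; rewrite -!raddfB; exact: dot_le_cabs.
have [->|Nn0] := eqVneq N 0.
  by rewrite -lee_fin -HE.
by move: key; rewrite expr2 ler_pM2l// lt_neqAle eq_sym Nn0.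
Qed.

End complex_integral.

(** * Averages over balls *)

(** The integral of a nonnegative function is a supremum over the simple
    functions below it, so it is monotone on all nonnegative functions,
    measurable or not.  This is what lets a bound on the transform be
    integrated in [b]. *)
Lemma ge0_le_integral_nonmeas d (T : measurableType d) (R : realType)
    (mu : {measure set T -> \bar R}) (D : set T) (f g : T -> \bar R) :
  (forall x, D x -> 0 <= f x)%E -> (forall x, D x -> f x <= g x)%E ->
  (\int[mu]_(x in D) f x <= \int[mu]_(x in D) g x)%E.
Proof.
move=> f0 fg; have g0 x : D x -> (0 <= g x)%E.
  by move=> Dx; exact: le_trans (f0 x Dx) (fg x Dx).
rewrite !ge0_integralE//; apply: ereal_sup_le => _ /= [h hf <-].
exists h => // x; apply: le_trans (hf x) _.
by rewrite !patchE; case: ifPn => // /[!inE] /fg.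
Qed.

Section balls.
Context (R : realType) (n : nat).
Local Notation mu := (lebesgue_Rn R n).
Implicit Types (a b c u x y t : Rn R n) (r : R).

Lemma absp_neq0 a i : absp a != 0 -> coord a i != 0.
Proof.
rewrite /absp normr_eq0; apply: contraNN => /eqP ai0.
by rewrite (bigD1 i)//= ai0 mul0r.
Qed.

Lemma measurable_subRn x : measurable_fun setT (fun t => subRn t x).
Proof.
apply/measurable_fun_tnthP => i.
rewrite (_ : _ \o _ = fun t => coord t i - coord x i); last first.
  by apply/funext => t /=; rewrite tnth_mktuple.
by apply: measurable_funB => //; exact: measurable_coord.
Qed.

Lemma measurable_divRn a : measurable_fun setT (fun t => divRn t a).
Proof.
apply/measurable_fun_tnthP => i.
rewrite (_ : _ \o _ = fun t => coord t i / coord a i); last first.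
  by apply/funext => t /=; rewrite tnth_mktuple.
by apply: measurable_funM => //; exact: measurable_coord.
Qed.

Lemma measurable_enorm : measurable_fun setT (@enorm R n).
Proof.
apply: (@measurableT_comp _ _ _ _ _ _ (@Num.sqrt R)).
  exact: continuous_measurable_fun (@sqrt_continuous R).
apply: measurable_sum => i.
by apply: measurable_funX; exact: measurable_coord.
Qed.

Lemma measurable_eball x r : measurable (eball x r).
Proof.
have mlt : measurable_fun setT (fun t => enorm (subRn t x) < r).
  apply: measurable_fun_ltr => //.
  by apply: measurableT_comp; [exact: measurable_enorm|exact: measurable_subRn].
by rewrite -[X in measurable X]setTI; exact: (mlt measurableT [set true]).
Qed.

Lemma eball_affRn x a u b r :
  eball (affRn x a u) r (affRn b a u) = eball x r b.
Proof.
rewrite /eball/=; congr (is_true (enorm _ < r)).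
apply: eq_from_tnth => i; rewrite !tnth_mktuple !coord_affRn.
by rewrite opprD addrACA subrr addr0.
Qed.

Lemma affRnK b a u : absp a != 0 -> divRn (subRn (affRn b a u) b) a = u.
Proof.
move=> a0; apply: eq_from_tnth => i.
rewrite tnth_mktuple /subRn /Defs.coord tnth_mktuple.
rewrite -!/(Defs.coord _ i) coord_affRn.
by rewrite addrAC subrr add0r mulrAC divff ?mul1r// absp_neq0.
Qed.

(** The map [b |-> b + a u] is the translation by [a u], which sends the ball
    centered at [x] onto the one centered at [x + a u]. *)
Lemma ge0_integral_eball_affRn x a u r (F : Rn R n -> \bar R) :
  measurable_fun setT F -> (forall t, 0 <= F t)%E ->
  (\int[mu]_(t in eball (affRn x a u) r) F t =
   \int[mu]_(b in eball x r) F (affRn b a u))%E.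
Proof.
move=> mF F0.
pose c : Rn R n := [tuple coord a i * coord u i | i < n].
pose one : Rn R n := [tuple 1 | i < n].
have one1 : absp one = 1.
  by rewrite /absp big1 ?normr1// => i _; rewrite /Defs.coord tnth_mktuple.
have affE b : affRn b a u = affRn c one b.
  apply: eq_from_tnth => i; rewrite !tnth_mktuple /Defs.coord !tnth_mktuple.
  by rewrite mul1r addrC.
rewrite integral_mkcond [RHS]integral_mkcond (ge0_integral_affRn c (a := one)).
- rewrite one1 mul1e; apply: eq_integral => b _.
  rewrite -affE !patchE; congr (if _ then _ else _).
  by apply/idP/idP; rewrite !inE eball_affRn.
- by rewrite one1 oner_neq0.
- apply: (measurable_restrictT F (measurable_eball _ _)).1.
  exact: measurable_funTS.
- by move=> t; exact: erestrict_ge0.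
Qed.

(** Young's inequality for the supremum over the balls of radius [r]: for each
    [u], the integral in [b] is the integral of [F] over the ball of radius [r]
    centered at [x + a u]. *)
Lemma integral_eball_convolution_le x a r (K : \bar R)
    (F X : Rn R n -> \bar R) :
  measurable_fun setT F -> (forall t, 0 <= F t)%E ->
  measurable_fun setT X -> (forall t, 0 <= X t)%E ->
  (forall y, \int[mu]_(t in eball y r) F t <= K)%E ->
  (\int[mu]_(b in eball x r) \int[mu]_u (F (affRn b a u) * X u)
     <= K * \int[mu]_u X u)%E.
Proof.
move=> mF F0 mX X0 FK.
have K0 : (0 <= K)%E by apply: le_trans (FK x); exact: integral_ge0.
pose ind (b : Rn R n) : \bar R := (\1_(eball x r) b)%:E.
have mind : measurable_fun setT ind.
  by apply/measurable_EFinP; apply: measurable_indic; exact: measurable_eball.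
have ind0 b : (0 <= ind b)%E by rewrite lee_fin.
have mFa : measurable_fun setT (fun p : Rn R n * Rn R n => F (affRn p.1 a p.2)).
  by apply: measurableT_comp => //; exact: measurable_affRn.
have mFb b : measurable_fun setT (fun u => F (affRn b a u)).
  by apply: measurableT_comp => //; exact: measurable_affRn.
have mFu u : measurable_fun setT (fun b => F (affRn b a u)).
  by apply: measurableT_comp => //; exact: measurable_affRn.
pose G (p : Rn R n * Rn R n) := (F (affRn p.1 a p.2) * X p.2 * ind p.1)%E.
have mG : measurable_fun setT G.
  apply: emeasurable_funM; last exact: measurableT_comp.
  by apply: emeasurable_funM => //; exact: measurableT_comp.
have G0 p : (0 <= G p)%E by rewrite /G !mule_ge0.
have -> : (\int[mu]_(b in eball x r) \int[mu]_u (F (affRn b a u) * X u) =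
    \int[mu]_b \int[mu]_u G (b, u))%E.
  rewrite integral_mkcond epatch_indic; apply: eq_integral => b _ /=.
  rewrite -ge0_integralZr//; first exact: emeasurable_funM.
  by move=> u _; rewrite mule_ge0.
rewrite fubini_tonelli//.
rewrite -ge0_integralZl//.
apply: ge0_le_integral_nonmeas => u _; first exact: integral_ge0.
have -> : (\int[mu]_b G (b, u) =
    X u * \int[mu]_(b in eball x r) F (affRn b a u))%E.
  rewrite [in RHS]integral_mkcond epatch_indic -ge0_integralZl//.
  - by apply: eq_integral => b _; rewrite /G/= muleA (muleC (X u)).
  - exact: emeasurable_funM.
  - by move=> b _; rewrite mule_ge0// lee_fin.
rewrite -ge0_integral_eball_affRn// muleC.
exact: lee_wpmul2r.
Qed.

End balls.

(** * Pointwise bound for the transform *)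

Section transform.
Context (R : realType) (n : nat) (alpha : R).
Local Notation mu := (lebesgue_Rn R n).
Implicit Types (f g phi psi : Rn R n -> R[i]) (a b t u : Rn R n).

Lemma measurable_div_subRn a b :
  measurable_fun setT (fun t => divRn (subRn t b) a).
Proof.
apply: (@measurableT_comp _ _ _ _ _ _ (fun t => divRn t a)).
  exact: measurable_divRn.
exact: measurable_subRn.
Qed.

Lemma cmeasurable_atom psi a b :
  cmeasurable psi -> cmeasurable (wavelet_atom alpha psi a b).
Proof.
move=> [mr mi].
have maff := measurable_div_subRn a b.
have mphase : measurable_fun setT
    (fun t => - (2^-1 * (enorm t ^+ 2 - enorm b ^+ 2) * cot alpha)).
  apply: measurable_funN; apply: measurable_funM => //.
  apply: measurable_funM => //; apply: measurable_funB => //.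
  by apply: measurable_funX; exact: measurable_enorm.
apply: cmeasurableM; first apply: cmeasurableM.
- by split => /=; exact: measurable_cst.
- by split; [exact: (measurableT_comp mr)|exact: (measurableT_comp mi)].
- split => /=.
    apply: (@measurableT_comp _ _ _ _ _ _ (@cos R)) => //.
    exact: continuous_measurable_fun (@continuous_cos R).
  apply: (@measurableT_comp _ _ _ _ _ _ (@sin R)) => //.
  exact: continuous_measurable_fun (@continuous_sin R).
Qed.

Lemma wavelet_atomB phi psi a b t :
  wavelet_atom alpha (phi \- psi) a b t =
  wavelet_atom alpha phi a b t - wavelet_atom alpha psi a b t.
Proof. by rewrite /wavelet_atom -mulrBl -mulrBr. Qed.

Lemma cabs_atom psi a b t :
  cabs (wavelet_atom alpha psi a b t) =
  (Num.sqrt (absp a))^-1 * cabs (psi (divRn (subRn t b) a)).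
Proof.
rewrite /wavelet_atom !cabsM cabs_cexpi mulr1 cabs_real.
by rewrite ger0_norm// invr_ge0 sqrtr_ge0.
Qed.

(** The convolution of [|f|] and [|psi|] at [b], except that the argument of
    [f] is [b + a u] in place of [b - u]. *)
Definition abs_conv a f psi b : \bar R :=
  (\int[mu]_u ((cabs (f (affRn b a u)))%:E * (cabs (psi u))%:E))%E.

(** The factor [1 / sqrt |a|_p] of the atoms times the Jacobian [|a|_p] of
    [t = b + a u] is [sqrt |a|_p]. *)
Lemma cabs_fcwtB_le phi psi f g a b :
  cmeasurable phi -> cmeasurable psi -> cmeasurable f -> cmeasurable g ->
  Rn0 a ->
  ((cabs (fcwt alpha phi f b a - fcwt alpha psi g b a))%:E <=
   (Num.sqrt (absp a))%:E *
     (abs_conv a f (phi \- psi)%R b + abs_conv a (f \- g)%R psi b))%E.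
Proof.
move=> mphi mpsi mf mg a0.
pose s : R := Num.sqrt (absp a).
have s0 : 0 < s by rewrite sqrtr_gt0 lt_def a0/= normr_ge0.
have matom h : cmeasurable h ->
    cmeasurable (fun t => conjc (wavelet_atom alpha h a b t)).
  by move=> mh; apply: cmeasurable_conj; exact: cmeasurable_atom.
apply: le_trans (cabs_cintegralB_le _ _) _.
- by apply: cmeasurableM => //; exact: matom.
- by apply: cmeasurableM => //; exact: matom.
pose P t : \bar R :=
  ((cabs (f t))%:E *
   (cabs ((phi \- psi)%R (divRn (subRn t b) a)))%:E)%E.
pose Q t : \bar R :=
  ((cabs ((f \- g)%R t))%:E * (cabs (psi (divRn (subRn t b) a)))%:E)%E.
have maff := measurable_div_subRn a b.
have mP : measurable_fun setT P.
  apply: emeasurable_funM; apply/measurable_EFinP; first exact: measurable_cabs.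
  exact: (measurableT_comp (measurable_cabs (cmeasurableB mphi mpsi)) maff).
have mQ : measurable_fun setT Q.
  apply: emeasurable_funM; apply/measurable_EFinP.
    exact: (measurable_cabs (cmeasurableB mf mg)).
  exact: (measurableT_comp (measurable_cabs mpsi) maff).
have P0 t : (0 <= P t)%E by rewrite mule_ge0// lee_fin cabs_ge0.
have Q0 t : (0 <= Q t)%E by rewrite mule_ge0// lee_fin cabs_ge0.
apply: (@le_trans _ _ (\int[mu]_t (s^-1%:E * (P t + Q t)))%E).
  apply: ge0_le_integral_nonmeas => t _; first by rewrite lee_fin cabs_ge0.
  rewrite lee_fin.
  have -> : f t * conjc (wavelet_atom alpha phi a b t) -
      g t * conjc (wavelet_atom alpha psi a b t) =
      f t * conjc (wavelet_atom alpha (phi \- psi) a b t) +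
      (f \- g) t * conjc (wavelet_atom alpha psi a b t).
    by rewrite wavelet_atomB rmorphB/= mulrBr mulrBl addrA subrK.
  apply: le_trans (cabsD _ _) _.
  by rewrite !cabsM !cabs_conj !cabs_atom mulrDr !(mulrCA s^-1).
have mPQ : measurable_fun setT (fun t => P t + Q t)%E.
  exact: emeasurable_funD.
have ma h : measurable_fun setT h ->
    measurable_fun setT (fun u => h (affRn b a u) : \bar R).
  by move=> mh; apply: measurableT_comp => //; exact: measurable_affRn.
rewrite ge0_integralZl//; last 2 first.
- by move=> t _; exact: adde_ge0.
- by rewrite lee_fin invr_ge0 ltW.
rewrite (ge0_integral_affRn b a0)//; last by move=> t; exact: adde_ge0.
rewrite ge0_integralD//; [|exact: ma..].
rewrite muleA -EFinM.
have -> : s^-1 * absp a = s.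
  by rewrite -[absp a]sqr_sqrtr ?normr_ge0// expr2 mulKf// gt_eqF.
rewrite le_eqVlt; apply/orP; left; apply/eqP; congr (_ * (_ + _))%E.
  by apply: eq_integral => u _; rewrite /P affRnK.
by apply: eq_integral => u _; rewrite /Q affRnK.
Qed.

End transform.

(** * Morrey norms *)

Section morrey.
Context (R : realType) (n : nat).
Local Notation mu := (lebesgue_Rn R n).

Lemma integral_eball_le_morrey nu (f : Rn R n -> R[i]) x r : 0 < r ->
  (\int[mu]_(t in eball x r) (cabs (f t))%:E <=
   (r `^ nu)%:E * morrey_norm nu f)%E.
Proof.
move=> r0; have rnu : 0 < r `^ nu by exact: powR_gt0.
rewrite -lee_pdivrMl//.
by apply: ereal_sup_ubound; exists x, r.
Qed.

Lemma cLnorm1E (f : Rn R n -> R[i]) :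
  cLnorm 1%E f = (\int[mu]_t (cabs (f t))%:E)%E.
Proof.
rewrite /cLnorm Lnorm1; apply: eq_integral => t _ /=.
by rewrite ger0_norm ?cabs_ge0.
Qed.

Lemma integral_eball_abs_conv_le nu a (f psi : Rn R n -> R[i]) x r :
  cmeasurable f -> cmeasurable psi -> 0 < r ->
  (\int[mu]_(b in eball x r) abs_conv a f psi b <=
   (r `^ nu)%:E * morrey_norm nu f * cLnorm 1 psi)%E.
Proof.
move=> mf mpsi r0; rewrite cLnorm1E.
apply: (@integral_eball_convolution_le _ _ x a r _ (EFin \o (@cabs R \o f))
  (EFin \o (@cabs R \o psi))) => //.
- by apply/measurable_EFinP; exact: measurable_cabs.
- by move=> t; rewrite lee_fin cabs_ge0.
- by apply/measurable_EFinP; exact: measurable_cabs.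
- by move=> t; rewrite lee_fin cabs_ge0.
- by move=> y; exact: integral_eball_le_morrey.
Qed.

Lemma measurable_abs_conv a (f psi : Rn R n -> R[i]) :
  cmeasurable f -> cmeasurable psi -> measurable_fun setT (abs_conv a f psi).
Proof.
move=> mf mpsi.
pose G (p : Rn R n * Rn R n) : \bar R :=
  ((cabs (f (affRn p.1 a p.2)))%:E * (cabs (psi p.2))%:E)%E.
have mG : measurable_fun setT G.
  apply: emeasurable_funM; apply/measurable_EFinP.
    apply: (measurableT_comp (measurable_cabs mf)).
    exact: measurable_affRn.
  by apply: (measurableT_comp (measurable_cabs mpsi)).
apply: (@measurable_fun_fubini_tonelli_F _ _ _ _ _ mu _ mG) => p.
by rewrite /G mule_ge0// lee_fin cabs_ge0.
Qed.

End morrey.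

Theorem theorem5p4 (R : realType) (n : nat) (nu alpha : R)
    (phi psi f g : Rn R n -> R[i]) (a : Rn R n) :
  (0 < n)%N -> 0 <= nu -> (forall k : int, alpha <> k%:~R * pi) ->
  in_L 1%E phi -> in_L 1%E psi ->
  is_wavelet alpha phi -> is_wavelet alpha psi ->
  in_morrey nu f -> in_morrey nu g ->
  Rn0 a ->
  (morrey_norm nu (fun b => (fcwt alpha phi f b a - fcwt alpha psi g b a)%R)
   <= (Num.sqrt (absp a))%:E *
      (morrey_norm nu f * cLnorm 1 (phi \- psi)%R +
       morrey_norm nu (f \- g)%R * cLnorm 1 psi))%E.
Proof.
move=> _ _ _ [mphi _] [mpsi _] _ _ [[mf _] _] [[mg _] _] a0.
apply: ge_ereal_sup => _ [x [r [r0 ->]]].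
have rnu : 0 < r `^ nu by exact: powR_gt0.
have mfg := cmeasurableB mf mg; have mpp := cmeasurableB mphi mpsi.
have M0 (h : Rn R n -> R[i]) : (0 <= morrey_norm nu h)%E.
  rewrite -(@lee_pmul2l _ (r `^ nu)%:E)// mule0.
  apply: le_trans (integral_eball_le_morrey _ _ x r0).
  by apply: integral_ge0 => t _; rewrite lee_fin cabs_ge0.
have N0 (h : Rn R n -> R[i]) : (0 <= cLnorm 1 h)%E by exact: Lnorm_ge0.
have C0 (h k : Rn R n -> R[i]) b : (0 <= abs_conv a h k b)%E.
  by apply: integral_ge0 => u _; rewrite mule_ge0// lee_fin cabs_ge0.
have mC (h k : Rn R n -> R[i]) : cmeasurable h -> cmeasurable k ->
    measurable_fun (eball x r) (abs_conv a h k).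
  by move=> mh mk; apply: measurable_funTS; exact: measurable_abs_conv.
rewrite lee_pdivrMl//.
apply: (@le_trans _ _ (\int[lebesgue_Rn R n]_(b in eball x r)
    ((Num.sqrt (absp a))%:E *
     (abs_conv a f (phi \- psi)%R b + abs_conv a (f \- g)%R psi b)))%E).
  apply: ge0_le_integral_nonmeas => b _; first by rewrite lee_fin cabs_ge0.
  exact: cabs_fcwtB_le.
have mB := measurable_eball x r.
rewrite ge0_integralZl//; last 2 first.
- by apply: emeasurable_funD; exact: mC.
- by move=> b _; exact: adde_ge0.
rewrite ge0_integralD//; [|exact: mC..].
rewrite muleCA lee_wpmul2l ?lee_fin ?sqrtr_ge0//.
rewrite ge0_muleDr ?mule_ge0// !muleA.
by apply: leeD; exact: integral_eball_abs_conv_le.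
Qed.
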